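(* Let $G=(V,E)$ be a connected graph. Then $G$ is bipartite if and only if for every edge $ab\in E$ the semicubes $W_{ab}$ and $W_{ba}$ form a partition of $V$ (that is, $W_{ab}\cap W_{ba}=\varnothing$ and $W_{ab}\cup W_{ba}=V$).
   Context: Graphs are simple, undirected, nonempty, and not necessarily finite. $d$ denotes the shortest-path distance in the connected graph $G$. For adjacent vertices $a,b\in V$ the semicube $W_{ab}$ is $W_{ab}=\{w\in V: d(w,a)<d(w,b)\}$; $W_{ab}$ and $W_{ba}$ are called opposite semicubes. *)

(* Defs.v *)
From mathcomp Require Import all_boot.
From mathcomp Require Import boolp classical_sets.

Set Implicit Arguments.
Unset Strict Implicit.
Unset Printing Implicit Defensive.

Local Open Scope classical_set_scope.

(* The vertex type may be infinite. Classically, decidable equality and a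
   boolean adjacency relation are no restriction. *)
Record sgraph := SGraph {
  vertex :> eqType;
  adj : rel vertex;
  adj_sym : symmetric adj;
  adj_irrefl : irreflexive adj;
  vertex_inhabited : inhabited vertex }.

Arguments adj {G} : rename.

(* [x :: p] is a path from [x] to [y] without repeated vertices; it has
   [size p] edges. [path] alone only describes walks. *)
Definition is_path (G : sgraph) (x y : G) (p : seq G) : bool :=
  [&& path adj x p, last x p == y & uniq (x :: p)].

Definition connected_graph (G : sgraph) : Prop :=
  forall x y : G, exists p, is_path x y p.

Definition path_length (G : sgraph) (x y : G) : pred nat :=
  fun n => `[< exists2 p, is_path x y p & size p = n >].

Lemma path_length_ex (G : sgraph) (Gc : connected_graph G) (x y : G) :
  exists n, path_length x y n.
Proof. by have [p xyp] := Gc x y; exists (size p); apply/asboolP; exists p. Qed.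

Definition dist (G : sgraph) (Gc : connected_graph G) (x y : G) : nat :=
  ex_minn (path_length_ex Gc x y).

(* It is meaningful only for adjacent [a] and [b]. *)
Definition semicube (G : sgraph) (Gc : connected_graph G) (a b : G) : set G :=
  [set w | dist Gc w a < dist Gc w b].

(* The two colour classes may be empty: the one-vertex graph is bipartite. *)
Definition bipartite (G : sgraph) : Prop :=
  exists A B : set G,
    [/\ A `&` B = set0, A `|` B = setT &
        forall x y : G, adj x y -> (A x /\ B y) \/ (B x /\ A y)].

(* Main.v *)
Require Import Defs.
From mathcomp Require Import all_boot.
From mathcomp Require Import boolp classical_sets.

(** The endpoints of an edge [ab] have distances to any vertex [w] differing by
    at most 1, so the semicubes of [ab] cover [w] iff these distances have
    different parities. A bipartition makes the parity of [d(w, a)] record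
    whether [w] and [a] have the same colour; conversely, the parity of the
    distance to a fixed root is a proper 2-colouring. *)

Local Open Scope classical_set_scope.

Lemma dist_witness (G : sgraph) (Gc : connected_graph G) (x y : G) :
  exists2 p, is_path x y p & size p = dist Gc x y.
Proof. by rewrite /dist; case: ex_minnP => n /asboolP. Qed.

(** Shortening a walk leaves a repetition-free path through some of its vertices, hence no longer
    than the walk. *)
Lemma dist_le_walk (G : sgraph) (Gc : connected_graph G) (x : G) (p : seq G) :
  path adj x p -> dist Gc x (last x p) <= size p.
Proof.
case/shortenP=> q xq uq sub_qp.
have /andP[_ uniq_q] := uq.
apply: leq_trans (uniq_leq_size uniq_q sub_qp).
rewrite /dist; case: ex_minnP => n _; apply.
by apply/asboolP; exists q; rewrite // /is_path xq eqxx.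
Qed.

(** Appending [b] to a shortest path from [w] to [a] may repeat [b], so the bound for walks is what
    applies. *)
Lemma dist_adj_leS (G : sgraph) (Gc : connected_graph G) (w a b : G) :
  adj a b -> dist Gc w b <= (dist Gc w a).+1.
Proof.
move=> ab; have [p /and3P[wp /eqP wa _] <-] := dist_witness G Gc w a.
have := dist_le_walk G Gc w (rcons p b).
by rewrite last_rcons size_rcons rcons_path wp wa; apply.
Qed.

Lemma semicubeI (G : sgraph) (Gc : connected_graph G) (a b : G) :
  semicube Gc a b `&` semicube Gc b a = set0.
Proof.
by rewrite -subset0 => w [/= ltab]; rewrite /semicube /= ltnNge (ltnW ltab).
Qed.

Lemma semicubeU (G : sgraph) (Gc : connected_graph G) (a b : G) :
  semicube Gc a b `|` semicube Gc b a = setT <->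
  forall w, dist Gc w a != dist Gc w b.
Proof.
rewrite -subTset; split=> [cov w | neq w _].
  by rewrite neq_ltn; apply/orP; case: (cov w I); [left | right].
by have := neq w; rewrite neq_ltn => /orP[]; [left | right].
Qed.

Lemma odd_dist_adj (G : sgraph) (Gc : connected_graph G) (w a b : G) :
  adj a b -> dist Gc w a != dist Gc w b ->
  odd (dist Gc w b) = ~~ odd (dist Gc w a).
Proof.
move=> ab; have := dist_adj_leS G Gc w a b ab.
have := dist_adj_leS G Gc w b a; rewrite adj_sym => /(_ ab).
rewrite neq_ltn => le_ab le_ba /orP[lt_ab | lt_ba].
  have -> : dist Gc w b = (dist Gc w a).+1; last by [].
  by apply/eqP; rewrite eqn_leq le_ba.
have -> : dist Gc w a = (dist Gc w b).+1; last by rewrite /= negbK.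
by apply/eqP; rewrite eqn_leq le_ab.
Qed.

(** Boolean colours let the bipartition be compared with parities by exclusive or. *)
Lemma bipartite_colouring (G : sgraph) :
  bipartite G <-> exists c : G -> bool, forall x y, adj x y -> c y = ~~ c x.
Proof.
split=> [[A [B [AB0 _ AB]]] | [c cP]].
  have disj z : A z -> B z -> False.
    by move=> Az Bz; have : (A `&` B) z by []; rewrite AB0.
  exists (fun x => `[< A x >]) => x y /AB[] [ ? ?].
    by rewrite (asboolT (P := A x)) // asboolF // => /disj; apply.
  by rewrite (asboolT (P := A y)) // asboolF // => /disj; apply.
exists [set x | c x], [set x | ~~ c x]; split.
- by rewrite -subset0 => x [/= ->].
- by rewrite -subTset => x _; case: (boolP (c x)); [left | right].
- by move=> x y /cP /= ->; case: (c x); [left | right].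
Qed.

(** Each edge of the walk flips the colour once. *)
Lemma colour_walk (G : sgraph) (c : G -> bool) (x : G) (p : seq G) :
  (forall x y, adj x y -> c y = ~~ c x) ->
  path adj x p -> c (last x p) = c x (+) odd (size p).
Proof.
move=> cP; elim: p x => [|y p IHp] x /=; first by rewrite addbF.
by case/andP=> /cP cy /IHp ->; rewrite cy addNb addbN.
Qed.

Theorem theorem3p1 (G : sgraph) (Gc : connected_graph G) :
  bipartite G <->
  (forall a b : G, adj a b ->
     semicube Gc a b `&` semicube Gc b a = set0 /\
     semicube Gc a b `|` semicube Gc b a = setT).
Proof.
rewrite bipartite_colouring; split=> [[c cP] a b ab | cov].
  split; first exact: semicubeI.
  (* If [w] were equidistant from [a] and [b], shortest paths from [w] would give both ends of the
     edge the same colour. *)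
  apply/semicubeU => w; apply/eqP => eq_d.
  have c_dist v : c v = c w (+) odd (dist Gc w v).
    have [p /and3P[wp /eqP <- _] <-] := dist_witness G Gc w v.
    exact: colour_walk.
  by have := cP a b ab; rewrite (c_dist a) (c_dist b) eq_d; case: (_ (+) _).
(* Any vertex can serve as root; the covering by the semicubes of [x] and [y], read at [r],
   separates the two distances. *)
have [r] := vertex_inhabited G.
exists (fun x => odd (dist Gc r x)) => x y xy.
apply: odd_dist_adj => //.
by have [_ /semicubeU] := cov x y xy; apply.
Qed.
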